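(* Let $t$ and $h$ be fixed complex numbers with $h\ne 0$, and let $p(z)$ be a polynomial in the variable $z$ with complex coefficients. (1) If $p$ has degree at most $5$, then the values $p(t-h)$, $p'(t-h)$, $p(t)$, $p(t+h)$ and $p'(t+h)$ determine $p''(t)$ uniquely. (2) If $p$ has degree at most $4$, then those same values $p(t-h)$, $p'(t-h)$, $p(t)$, $p(t+h)$ and $p'(t+h)$ determine $p'(t)$ uniquely.
   Context: ''The values determine $p''(t)$ uniquely'' means: if $p$ and $q$ are two polynomials satisfying the degree bound which agree in the five listed values (i.e. $p(t\pm h)=q(t\pm h)$, $p'(t\pm h)=q'(t\pm h)$, $p(t)=q(t)$), then $p''(t)=q''(t)$; similarly for $p'(t)$. *)

(* Defs.v *)
From mathcomp Require Import all_boot all_order all_algebra.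
From mathcomp Require Import complex reals.
Set Implicit Arguments.
Unset Strict Implicit.
Unset Printing Implicit Defensive.
Import GRing.Theory.
Local Open Scope ring_scope.

Definition same_data (F : fieldType) (t h : F) (p q : {poly F}) : Prop :=
  [/\ p.[t - h] = q.[t - h],
      p^`().[t - h] = q^`().[t - h],
      p.[t] = q.[t],
      p.[t + h] = q.[t + h]
    & p^`().[t + h] = q^`().[t + h]].

(* The zero polynomial, of size 0, satisfies every degree bound. *)
Definition degree_le (F : fieldType) (d : nat) (p : {poly F}) : Prop :=
  (size p <= d.+1)%N.

(* Main.v *)
Require Import Defs.
From mathcomp Require Import all_boot all_order all_algebra.
From mathcomp Require Import complex reals.
From mathcomp Require Import ring.
Set Implicit Arguments.
Unset Strict Implicit.
Unset Printing Implicit Defensive.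
Import GRing.Theory.
Local Open Scope ring_scope.

(** The Hermite-type difference formulas
      [2 h^2 p''(t) = 4 (p(t+h) - 2 p(t) + p(t-h)) - h (p'(t+h) - p'(t-h))],
      [4 h p'(t) = 3 (p(t+h) - p(t-h)) - h (p'(t+h) + p'(t-h))]
    are exact in degree at most 5 and at most 4 respectively: the combinations
    on the right cancel the degree-4 (resp. degree-3) Taylor coefficient at
    [t], and parity removes the others.  As [h != 0] in characteristic 0, they
    recover [p''(t)] and [p'(t)] from the data. *)

(** Explicit coefficients turn the difference formulas into identities that [ring] can check. *)
Lemma horner_size6 (A : comNzRingType) (p : {poly A}) (x : A) :
  (size p <= 6)%N ->
  p.[x] = p`_0 + p`_1 * x + p`_2 * x ^+ 2 + p`_3 * x ^+ 3 + p`_4 * x ^+ 4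
          + p`_5 * x ^+ 5.
Proof.
move=> sp; rewrite (horner_coef_wide _ sp) !big_ord_recr big_ord0 /=.
by rewrite add0r expr0 mulr1 expr1.
Qed.

(** The bound is kept at [n] so that [horner_size6] serves the polynomial and its derivatives
    alike. *)
Lemma size_deriv_le (A : nzRingType) (p : {poly A}) (n : nat) :
  (size p <= n)%N -> (size p^`() <= n)%N.
Proof. exact/leq_trans/leq_trans/leq_pred/size_poly. Qed.

Lemma deriv2_formula (A : comNzRingType) (p : {poly A}) (t h : A) :
  (size p <= 6)%N ->
  2%:R * h ^+ 2 * p^`(2).[t] =
  4%:R * (p.[t + h] - 2%:R * p.[t] + p.[t - h])
  - h * (p^`().[t + h] - p^`().[t - h]).
Proof.
move=> sp; have sp1 := size_deriv_le sp.
have sp2 := size_deriv_le sp1.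
(* The six-term expansions of the two derivatives reach the coefficients of index 6 and 7 of [p],
   which vanish. *)
rewrite derivSn derivn1 !horner_size6 // !coef_deriv (nth_default 0 sp).
by rewrite [p`_7]nth_default ?(leq_trans sp) //; ring.
Qed.

Lemma deriv_formula (A : comNzRingType) (p : {poly A}) (t h : A) :
  (size p <= 5)%N ->
  4%:R * h * p^`().[t] =
  3%:R * (p.[t + h] - p.[t - h]) - h * (p^`().[t + h] + p^`().[t - h]).
Proof.
move=> sp; have sp6 : (size p <= 6)%N by apply: leq_trans sp _.
have sp1 := size_deriv_le sp6.
(* The vanishing of the coefficient of index 5 is essential: a term $c(z-t)^5$ would add $-4ch^5$ to
   the right side only. *)
rewrite !horner_size6 // !coef_deriv (nth_default 0 sp) (nth_default 0 sp6).
ring.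
Qed.

Theorem theorem5p1 (R : realType) (t h : R[i]) (hn0 : h != 0) :
  (forall p q : {poly R[i]}, degree_le 5 p -> degree_le 5 q ->
     same_data t h p q -> p^`(2).[t] = q^`(2).[t]) /\
  (forall p q : {poly R[i]}, degree_le 4 p -> degree_le 4 q ->
     same_data t h p q -> p^`().[t] = q^`().[t]).
Proof.
split=> p q sp sq [Epm Edm Ep Epp Edp].
- have c0 : 2%:R * h ^+ 2 != 0.
    by rewrite mulf_neq0 ?expf_neq0 ?Num.Theory.pnatr_eq0.
  by apply: (mulfI c0); rewrite !deriv2_formula // Epm Edm Ep Epp Edp.
- have c0 : 4%:R * h != 0 by rewrite mulf_neq0 ?Num.Theory.pnatr_eq0.
  by apply: (mulfI c0); rewrite !deriv_formula // Epm Edm Epp Edp.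
Qed.
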